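(* (Monotonicity of $Q(\cdot,a)$.) The $Q$-factor of the costly communication problem satisfies, for each action $a\in\mathbb A$, $$Q(\tau,a)\ge Q(\tau',a),\qquad\forall\,\tau\ge\tau'.$$
   Context: System: $x(k+1)=Ax(k)+w(k)$, $y(k)=Cx(k)+v(k)$, with mutually independent $w(k)\sim\mathcal N(0,\Sigma_w)$, $v(k)\sim\mathcal N(0,\Sigma_v)$, $x(0)\sim\mathcal N(0,\Pi)$; $\Sigma_w,\Pi$ positive semidefinite, $\Sigma_v$ positive definite, $(A,C)$ detectable, $(A,\sqrt{\Sigma_w})$ stabilizable. A sensor runs a Kalman filter, assumed to be in steady state, with steady-state error covariance $\overline P$, and may send its estimate over a packet-dropping channel to a remote estimator. If $\tau$ is the time elapsed since the last successful transmission, the remote error covariance is $P(0)=\overline P$ and $P(\tau)=A^\tau\overline P(A^\top)^\tau+\sum_{t=0}^{\tau-1}A^t\Sigma_w(A^\top)^t$ for $\tau\ge1$. Markov decision process (costly communication problem): states $\tau\in\mathbb S=\mathbb N=\{0,1,2,\dots\}$, actions $\mathbb A=\{0,1\}$ ($1$ = transmit), one-stage cost $c(\tau,a)=\operatorname{Tr}P(\tau)+\lambda a$, where $\lambda$ is the given communication cost for one transmission. With $r_s$ the probability that a transmission succeeds, the transitions are $\Pr(0\mid\tau,1)=r_s$, $\Pr(\tau+1\mid\tau,1)=1-r_s$, $\Pr(\tau+1\mid\tau,0)=1$, all others $0$. The objective is to minimize the long-run expected average of $c(\tau(k),a(k))$ starting from $\tau(0)=0$. The relative value function $V$ on $\mathbb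 S$ is obtained by solving, with respect to a constant $\mathcal J^\star$ and $V$, the Bellman optimality equation $$V(\tau)=\min_{a\in\mathbb A}\Big[c(\tau,a)+\sum_{\tau_+}V(\tau_+)\Pr(\tau_+\mid\tau,a)-\mathcal J^\star\Big].$$ The $Q$-factor is $Q(\tau,a)=c(\tau,a)+\sum_{\tau_+}V(\tau_+)\Pr(\tau_+\mid\tau,a)-\mathcal J^\star$, so that $V(\tau)=\min_{a\in\mathbb A}Q(\tau,a)$.
   Formalization: The constant J* is taken to be the finite optimal average cost, and when r_s = 1 the relative value function V is additionally required to be bounded below; without this, Bellman's equation has solutions tending to minus infinity for which Q(·,0) is not monotone. *)

(* Defs.v *)
From HB Require Import structures.
From mathcomp Require Import all_boot all_order all_algebra.
From mathcomp Require Import all_classical all_reals all_analysis.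
From mathcomp Require Import complex.

Set Implicit Arguments.
Unset Strict Implicit.
Unset Printing Implicit Defensive.

Import Order.TTheory GRing.Theory Num.Theory.
Import numFieldNormedType.Exports.

Local Open Scope classical_set_scope.
Local Open Scope ring_scope.

Definition possemidef (R : realType) (n : nat) (X : 'M[R]_n) : Prop :=
  X^T = X /\ forall u : 'rV[R]_n, 0 <= (u *m X *m u^T) ord0 ord0.

Definition posdef (R : realType) (n : nat) (X : 'M[R]_n) : Prop :=
  X^T = X /\ forall u : 'rV[R]_n, u != 0 -> 0 < (u *m X *m u^T) ord0 ord0.

Definition is_sqrt_mx (R : realType) (n : nat) (S X : 'M[R]_n) : Prop :=
  possemidef S /\ S *m S = X.

(* Discrete-time (Schur) stability: the complex eigenvalues of the real matrix
   lie in the open unit disc. *)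
Definition schur_stable (R : realType) (n : nat) (M : 'M[R]_n) : Prop :=
  forall z : R[i], eigenvalue (map_mx (real_complex R) M) z -> `|z| < 1.

Definition detectable (R : realType) (n p : nat)
    (A : 'M[R]_n) (C : 'M[R]_(p, n)) : Prop :=
  exists L : 'M[R]_(n, p), schur_stable (A - L *m C).

Definition stabilizable (R : realType) (n q : nat)
    (A : 'M[R]_n) (B : 'M[R]_(n, q)) : Prop :=
  exists K : 'M[R]_(q, n), schur_stable (A - B *m K).

Definition time_update (R : realType) (n : nat) (A Sw X : 'M[R]_n) : 'M[R]_n :=
  A *m X *m A^T + Sw.

Definition kalman_gain (R : realType) (n p : nat)
    (C : 'M[R]_(p, n)) (Sv : 'M[R]_p) (X : 'M[R]_n) : 'M[R]_(n, p) :=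
  X *m C^T *m invmx (C *m X *m C^T + Sv).

Definition measurement_update (R : realType) (n p : nat)
    (C : 'M[R]_(p, n)) (Sv : 'M[R]_p) (X : 'M[R]_n) : 'M[R]_n :=
  X - kalman_gain C Sv X *m C *m X.

(* Error covariance of the estimate of x(k) given y(0), ..., y(k); the prior
   covariance of x(0) is Pi0. *)
Fixpoint kalman_cov (R : realType) (n p : nat) (A : 'M[R]_n)
    (C : 'M[R]_(p, n)) (Sw : 'M[R]_n) (Sv : 'M[R]_p) (Pi0 : 'M[R]_n)
    (k : nat) : 'M[R]_n :=
  if k is k'.+1
  then measurement_update C Sv
         (time_update A Sw (kalman_cov A C Sw Sv Pi0 k'))
  else measurement_update C Sv Pi0.

Definition steady_state_cov (R : realType) (n p : nat) (A : 'M[R]_n)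
    (C : 'M[R]_(p, n)) (Sw : 'M[R]_n) (Sv : 'M[R]_p) (Pi0 Pbar : 'M[R]_n)
    : Prop :=
  forall i j : 'I_n,
    (fun k : nat => kalman_cov A C Sw Sv Pi0 k i j) @ \oo --> Pbar i j.

(* At tau = 0 the sum is empty and the value is Pbar. *)
Definition remote_cov (R : realType) (n : nat) (A Sw Pbar : 'M[R]_n)
    (tau : nat) : 'M[R]_n :=
  A ^+ tau *m Pbar *m A^T ^+ tau
  + \sum_(t < tau) A ^+ t *m Sw *m A^T ^+ t.

(* Actions are booleans, true meaning "transmit". *)
Definition stage_cost (R : realType) (n : nat) (A Sw Pbar : 'M[R]_n)
    (lambda : R) (tau : nat) (a : bool) : R :=
  \tr (remote_cov A Sw Pbar tau) + lambda * a%:R.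

Definition trans_prob (R : realType) (rs : R) (tau : nat) (a : bool)
    (tau' : nat) : R :=
  if tau' == 0%N then (if a then rs else 0)
  else if tau' == tau.+1 then (if a then 1 - rs else 1)
  else 0.

(* The sum stops at tau + 1 because trans_prob vanishes beyond. *)
Definition expect_next (R : realType) (rs : R) (tau : nat) (a : bool)
    (V : nat -> R) : R :=
  \sum_(tau' < tau.+2) V tau' * trans_prob rs tau a tau'.

(* History-dependent randomized policies: pi h tau is the probability of
   transmitting in the current state tau after the past state-action pairs h
   (oldest first). *)
Definition policy (R : realType) : Type := seq (nat * bool) -> nat -> R.

Definition is_policy (R : realType) (pi : policy R) : Prop :=
  forall h tau, 0 <= pi h tau <= 1.

Definition action_prob (R : realType) (pi : policy R)
    (h : seq (nat * bool)) (tau : nat) (a : bool) : R :=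
  if a then pi h tau else 1 - pi h tau.

(* Expected total cost of the next N stages given the past h and the current
   state tau, by conditioning on the current action and the next state. *)
Fixpoint expected_cost (R : realType) (rs : R) (c : nat -> bool -> R)
    (pi : policy R) (N : nat) (h : seq (nat * bool)) (tau : nat) : R :=
  if N is N'.+1 then
    \sum_(a : bool) action_prob pi h tau a *
      (c tau a + expect_next rs tau a
                   (expected_cost rs c pi N' (rcons h (tau, a))))
  else 0.

Definition average_cost (R : realType) (rs : R) (c : nat -> bool -> R)
    (pi : policy R) : \bar R :=
  limn_esup (fun N : nat => (expected_cost rs c pi N [::] 0%N / N%:R)%:E).

Definition optimal_average_cost (R : realType) (rs : R)
    (c : nat -> bool -> R) : \bar R :=
  ereal_inf [set average_cost rs c pi | pi in @is_policy R].

Definition Qfactor (R : realType) (rs : R) (c : nat -> bool -> R)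
    (J : R) (V : nat -> R) (tau : nat) (a : bool) : R :=
  c tau a + expect_next rs tau a V - J.

Definition bellman (R : realType) (rs : R) (c : nat -> bool -> R)
    (J : R) (V : nat -> R) : Prop :=
  forall tau, V tau =
    Num.min (Qfactor rs c J V tau false) (Qfactor rs c J V tau true).

(* The Bellman equation alone does not determine J: for rs < 1 it can be solved
   forwards from V 0 for every real J, so J has to be the optimal average cost,
   which then determines V up to an additive constant.  For rs = 1 the values
   of V at states that an optimal policy never reaches stay undetermined, and
   there are spurious solutions tending to -oo; they are excluded by the usual
   requirement that a relative value function be bounded below. *)
Definition relative_value_function (R : realType) (rs : R)
    (c : nat -> bool -> R) (J : R) (V : nat -> R) : Prop :=
  [/\ optimal_average_cost rs c = J%:E,
      bellman rs c J V &
      rs = 1 -> exists m : R, forall tau, m <= V tau].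

(* Main.v *)
(* The trace of P(tau) is nondecreasing because P(tau+1) - P(tau) is congruent
   to [time_update Pbar - Pbar], which is positive semidefinite.  Up to
   nonnegative terms, monotonicity of Q then amounts to that of V.  Suppose
   V(T+1) < V(T).  If rs = 1, the Bellman equation propagates this descent with
   a step bounded away from 0, so V is unbounded below.  If rs < 1, the Bellman
   inequalities at T are strict when V(T+1) is replaced by V(T), and this slack
   yields a bounded subsolution of the Bellman equation for some constant
   J + e > J; every policy then has average cost at least J + e, contradicting
   the optimality of J. *)

Require Import Defs.
From HB Require Import structures.
From mathcomp Require Import all_boot all_order all_algebra.
From mathcomp Require Import all_classical all_reals all_analysis.
From mathcomp Require Import lra ring.

Set Implicit Arguments.
Unset Strict Implicit.
Unset Printing Implicit Defensive.

Import Order.TTheory GRing.Theory Num.Theory.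
Import numFieldNormedType.Exports.

Local Open Scope ring_scope.

(** * Positive semidefinite matrices *)

Lemma possemidef_congr (R : realType) (m n : nat) (B : 'M[R]_(m, n))
    (X : 'M[R]_n) : possemidef X -> possemidef (B *m X *m B^T).
Proof.
move=> [sX pX]; split; first by rewrite !trmx_mul trmxK sX mulmxA.
by move=> u; have := pX (u *m B); rewrite trmx_mul !mulmxA.
Qed.

Lemma possemidefD (R : realType) (n : nat) (X Y : 'M[R]_n) :
  possemidef X -> possemidef Y -> possemidef (X + Y).
Proof.
move=> [sX pX] [sY pY]; split; first by rewrite linearD /= sX sY.
by move=> u; rewrite mulmxDr mulmxDl mxE addr_ge0.
Qed.

Lemma posdef_possemidef (R : realType) (n : nat) (X : 'M[R]_n) :
  posdef X -> possemidef X.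
Proof.
move=> [sX pX]; split=> // u; have [->|/pX/ltW//] := eqVneq u 0.
by rewrite !mul0mx mxE.
Qed.

Lemma posdefD (R : realType) (n : nat) (X Y : 'M[R]_n) :
  possemidef X -> posdef Y -> posdef (X + Y).
Proof.
move=> [sX pX] [sY pY]; split; first by rewrite linearD /= sX sY.
by move=> u u0; rewrite mulmxDr mulmxDl mxE ltr_wpDl ?pX ?pY.
Qed.

Lemma posdef_unitmx (R : realType) (n : nat) (X : 'M[R]_n) :
  posdef X -> X \in unitmx.
Proof.
move=> [_ pX]; rewrite -row_free_unit -kermx_eq0; apply/eqP/row_matrixP => i.
rewrite row0; apply/eqP/negPn/negP => /pX.
by rewrite -row_mul mulmx_ker row0 mul0mx mxE ltxx.
Qed.

Lemma posdef_invmx (R : realType) (n : nat) (X : 'M[R]_n) :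
  posdef X -> possemidef (invmx X).
Proof.
move=> dX; have uX := posdef_unitmx dX.
have [sX _] := posdef_possemidef dX.
have -> : invmx X = invmx X *m X *m (invmx X)^T.
  by rewrite mulVmx // mul1mx trmx_inv sX.
exact/possemidef_congr/posdef_possemidef.
Qed.

(** Assumes only the quadratic form condition, as [steady_state_cov_le_time_update] delivers it;
    basis vectors pick out the diagonal entries. *)
Lemma trace_possemidef_ge0 (R : realType) (n : nat) (X : 'M[R]_n) :
  (forall u : 'rV[R]_n, 0 <= (u *m X *m u^T) ord0 ord0) -> 0 <= \tr X.
Proof.
move=> pX; apply: sumr_ge0 => i _; have := pX (delta_mx ord0 i).
by rewrite -rowE trmx_delta -colE !mxE.
Qed.

Lemma trmx_expr (R : comNzRingType) (n : nat) (A : 'M[R]_n) (k : nat) :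
  (A ^+ k)^T = A^T ^+ k.
Proof.
elim: k => [|k IHk]; first by rewrite !expr0 trmx1.
by rewrite exprS exprSr trmx_mul IHk.
Qed.

(** * Kalman covariances and the trace of the remote error covariance *)

Section KalmanFilter.

Variables (R : realType) (n p : nat) (A : 'M[R]_n) (C : 'M[R]_(p, n)).
Variables (Sw : 'M[R]_n) (Sv : 'M[R]_p).
Hypotheses (hSw : possemidef Sw) (hSv : posdef Sv).

Lemma time_update_possemidef (X : 'M[R]_n) :
  possemidef X -> possemidef (time_update A Sw X).
Proof. by move=> pX; apply: possemidefD => //; apply: possemidef_congr. Qed.

Lemma innovation_posdef (X : 'M[R]_n) :
  possemidef X -> posdef (C *m X *m C^T + Sv).
Proof. by move=> pX; apply: posdefD => //; apply: possemidef_congr. Qed.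

(** The difference is the inverse innovation covariance, congruence-transformed by [X *m C^T]. *)
Lemma sub_measurement_update_possemidef (X : 'M[R]_n) :
  possemidef X -> possemidef (X - measurement_update C Sv X).
Proof.
move=> pX; have [sX _] := pX.
rewrite /measurement_update opprB addrC subrK /kalman_gain.
have -> : X *m C^T *m invmx (C *m X *m C^T + Sv) *m C *m X =
    (X *m C^T) *m invmx (C *m X *m C^T + Sv) *m (X *m C^T)^T.
  by rewrite trmx_mul trmxK sX !mulmxA.
exact/possemidef_congr/posdef_invmx/innovation_posdef.
Qed.

(** Joseph form: a sum of two congruences, from which positive semidefiniteness can be read off. It
    rests on the gain equation [KS]. *)
Lemma measurement_update_joseph (X : 'M[R]_n) : possemidef X ->
  let K := kalman_gain C Sv X in
  measurement_update C Sv X =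
    (1%:M - K *m C) *m X *m (1%:M - K *m C)^T + K *m Sv *m K^T.
Proof.
move=> pX K; have [sX _] := pX.
have KS : K *m (C *m X *m C^T + Sv) = X *m C^T.
  by rewrite mulmxKV //; apply/posdef_unitmx/innovation_posdef.
have KSv : K *m Sv = (1%:M - K *m C) *m X *m C^T.
  by rewrite !mulmxBl mul1mx -KS mulmxDr !mulmxA addrAC subrr add0r.
rewrite KSv linearB /= trmx1 trmx_mul mulmxBr mulmx1 mulmxA subrK.
by rewrite mulmxBl mul1mx.
Qed.

Lemma measurement_update_possemidef (X : 'M[R]_n) :
  possemidef X -> possemidef (measurement_update C Sv X).
Proof.
move=> pX; rewrite measurement_update_joseph //.
by apply: possemidefD; apply: possemidef_congr => //; exact: posdef_possemidef.
Qed.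

Lemma kalman_cov_possemidef (Pi0 : 'M[R]_n) (k : nat) :
  possemidef Pi0 -> possemidef (kalman_cov A C Sw Sv Pi0 k).
Proof.
move=> pPi; elim: k => [|k IHk]; apply: measurement_update_possemidef => //.
exact: time_update_possemidef.
Qed.

Lemma cvg_mulmx_entry (m q : nat) (X : nat -> 'M[R]_n) (L : 'M[R]_n)
    (B : 'M[R]_(m, n)) (D : 'M[R]_(n, q)) (i : 'I_m) (j : 'I_q) :
  (forall i j, X k i j @[k --> \oo] --> L i j)%classic ->
  ((B *m X k *m D) i j @[k --> \oo] --> (B *m L *m D) i j)%classic.
Proof.
move=> XL.
under eq_cvg do rewrite mxE; rewrite mxE.
apply: cvg_big => [|l _]; first exact: add_continuous.
apply: cvgMr_tmp; under eq_cvg do rewrite mxE; rewrite mxE.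
apply: cvg_big => [|l' _]; first exact: add_continuous.
exact: cvgMl_tmp.
Qed.

(* Passing to the limit in kalman_cov (k+1) <= time_update (kalman_cov k)
   avoids the continuity of [invmx]. *)
Lemma steady_state_cov_le_time_update (Pi0 Pbar : 'M[R]_n) :
  possemidef Pi0 -> steady_state_cov A C Sw Sv Pi0 Pbar ->
  forall u : 'rV[R]_n,
    0 <= (u *m (time_update A Sw Pbar - Pbar) *m u^T) ord0 ord0.
Proof.
move=> pPi cvP u; set P := kalman_cov A C Sw Sv Pi0.
have quadE (X Y : 'M[R]_n) :
    (u *m (time_update A Sw X - Y) *m u^T) ord0 ord0 =
    ((u *m A) *m X *m (A^T *m u^T)) ord0 ord0 + (u *m Sw *m u^T) ord0 ord0
    - (u *m Y *m u^T) ord0 ord0.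
  rewrite /time_update mulmxBr mulmxBl mulmxDr mulmxDl !mulmxA.
  by rewrite [LHS]mxE [X in X + _]mxE [X in _ + X]mxE.
have cvS i j : (P k.+1 i j @[k --> \oo] --> Pbar i j)%classic.
  by rewrite (cvg_shiftS (fun k => P k i j)); exact: cvP.
have cvq : ((u *m (time_update A Sw (P k) - P k.+1) *m u^T) ord0 ord0
    @[k --> \oo] -->
    (u *m (time_update A Sw Pbar - Pbar) *m u^T) ord0 ord0)%classic.
  under eq_cvg do rewrite quadE; rewrite quadE.
  apply: cvgB; last exact: cvg_mulmx_entry.
  by apply: cvgD; [exact: cvg_mulmx_entry | exact: cvg_cst].
rewrite -(cvg_lim _ cvq) //; apply: limr_ge; first exact: cvgP cvq.
(* [P k.+1] is the measurement update of [time_update A Sw (P k)], so each term of the sequence is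
   nonnegative. *)
apply: nearW => k.
by have [_] := sub_measurement_update_possemidef
  (time_update_possemidef (kalman_cov_possemidef k pPi)).
Qed.

Lemma remote_covS (Pbar : 'M[R]_n) (tau : nat) :
  remote_cov A Sw Pbar tau.+1 = remote_cov A Sw Pbar tau +
    A ^+ tau *m (time_update A Sw Pbar - Pbar) *m (A ^+ tau)^T.
Proof.
have ASr : A ^+ tau.+1 = A ^+ tau *m A by rewrite exprSr.
have ASl : A^T ^+ tau.+1 = A^T *m A^T ^+ tau by rewrite exprS.
rewrite /remote_cov /time_update big_ord_recr /= ASr ASl trmx_expr.
rewrite mulmxBr mulmxDr mulmxBl mulmxDl !mulmxA.
by rewrite [X in _ = X + _]addrC -[RHS]addrA [X in _ = _ + X]addrC subrK addrCA.
Qed.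

Lemma trace_remote_cov_le (Pi0 Pbar : 'M[R]_n) :
  possemidef Pi0 -> steady_state_cov A C Sw Sv Pi0 Pbar ->
  {homo (fun tau => \tr (remote_cov A Sw Pbar tau)) :
     s t / (s <= t)%N >-> s <= t}.
Proof.
move=> pPi cvP; apply: homo_leq => [//||tau]; first exact: le_trans.
rewrite remote_covS mxtraceD lerDl; apply: trace_possemidef_ge0 => u.
have := steady_state_cov_le_time_update pPi cvP (u *m A ^+ tau).
by rewrite trmx_mul !mulmxA.
Qed.

End KalmanFilter.

(** * Lower bound on the average cost from a subsolution of the Bellman equation *)

Section AverageCost.

Variables (R : realType) (rs : R) (c : nat -> bool -> R).
Hypothesis hrs : 0 <= rs <= 1.

Lemma expect_nextE (tau : nat) (a : bool) (V : nat -> R) :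
  expect_next rs tau a V =
  V 0%N * (if a then rs else 0) + V tau.+1 * (if a then 1 - rs else 1).
Proof.
rewrite /expect_next big_ord_recl big_ord_recr /= /trans_prob /=.
rewrite big1 ?add0r => [|i _]; first by rewrite /bump /= !add1n eqxx.
by rewrite /bump /= !add1n eqSS ltn_eqF ?ltn_ord// mulr0.
Qed.

(** Under either action, hence under any mixture, a stage costs at least [g] plus the expected drop
    of [W]. The drops telescope over the horizon, and [B] bounds the terminal value of [W]. *)
Lemma expected_cost_ge (pi : policy R) (g B : R) (W : nat -> R) :
  is_policy pi ->
  (forall tau a, W tau <= Qfactor rs c g W tau a) ->
  (forall tau, W tau <= B) ->
  forall N h tau, N%:R * g + W tau - B <= expected_cost rs c pi N h tau.
Proof.
move=> ppi WQ WB; elim=> [|N IHN] h tau /=.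
  by rewrite mul0r add0r subr_le0.
have step a : N.+1%:R * g + W tau - B <= c tau a +
    expect_next rs tau a (expected_cost rs c pi N (rcons h (tau, a))).
  have /andP[rs0]:= hrs; rewrite -subr_ge0 => rs1.
  have := WQ tau a; rewrite /Qfactor !expect_nextE -natr1 mulrDl mul1r.
  move: (expected_cost rs c pi N (rcons h (tau, a))) (IHN (rcons h (tau, a))).
  move=> E IHE.
  have E0 : N%:R * g + W 0%N - B <= E 0%N := IHE _.
  have ES : N%:R * g + W tau.+1 - B <= E tau.+1 := IHE _.
  have := ler_wpM2l rs0 E0; have := ler_wpM2l rs1 ES.
  by case: a => /=; lra.
have /andP[pi0 pi1] := ppi h tau.
rewrite big_bool /action_prob /=.
have := ler_wpM2l pi0 (step true).
rewrite -subr_ge0 in pi1; have := ler_wpM2l pi1 (step false); lra.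
Qed.

Lemma average_cost_ge (pi : policy R) (g h B : R) (W : nat -> R) :
  is_policy pi ->
  (forall tau a, W tau <= Qfactor rs c g W tau a) ->
  (forall tau, W tau <= B) ->
  h < g -> (h%:E <= average_cost rs c pi)%E.
Proof.
move=> ppi WQ WB hg; rewrite /average_cost /limn_esup limf_esupE.
apply: le_ereal_inf_tmp => _ [S nS <-].
(* The limit superior is an infimum of suprema over the sets [S] of the filter, so one [N] in each
   [S] suffices; the threshold gives [N * (g - h) >= B - W 0]. *)
have [N [SN N0 hN]] : exists N : nat,
    [/\ S N, (0 < N)%N & (B - W 0%N) / (g - h) <= N%:R].
  have [N /= [? []]] : exists N, (S `&` ([set N | (0 < N)%N] `&`
      [set N | (B - W 0%N) / (g - h) <= N%:R]))%classic N.
    apply: (@filter_ex _ \oo%classic); apply: filterI => //; apply: filterI.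
      exact: nbhs_infty_gt.
    exact: nbhs_infty_ger.
  by exists N.
apply: le_trans (ereal_sup_ubound _); last by exists N.
rewrite lee_fin ler_pdivlMr ?ltr0n//.
apply: le_trans (expected_cost_ge ppi WQ WB N [::] 0%N).
by move: hN; rewrite ler_pdivrMr ?subr_gt0//; lra.
Qed.

End AverageCost.

(** * Monotonicity of the relative value function *)

Section RelativeValueFunction.

Variables (R : realType) (f : nat -> R) (c : nat -> bool -> R).
Variables (lambda rs J : R) (V : nat -> R).
Hypothesis hf : {homo f : s t / (s <= t)%N >-> s <= t}.
Hypothesis cE : forall tau a, c tau a = f tau + lambda * a%:R.
Hypothesis hrs : 0 <= rs <= 1.
Hypothesis hV : relative_value_function rs c J V.

Lemma bellman_le (tau : nat) :
  V tau <= f tau + V tau.+1 - J /\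
  V tau <= f tau + lambda + (V 0%N * rs + V tau.+1 * (1 - rs)) - J.
Proof.
have [_ /(_ tau) VE _] := hV.
have : V tau <= Num.min (Qfactor rs c J V tau false) (Qfactor rs c J V tau true).
  by rewrite -VE.
rewrite le_min /Qfactor !expect_nextE !cE /= => /andP[]; lra.
Qed.

Lemma bellman_attained (tau : nat) :
  V tau = f tau + V tau.+1 - J \/
  V tau = f tau + lambda + (V 0%N * rs + V tau.+1 * (1 - rs)) - J.
Proof.
have [_ /(_ tau) -> _] := hV; rewrite /Qfactor !expect_nextE !cE /=.
by case: leP => _; [left|right]; ring.
Qed.

(** If transmitting attained the minimum at [T+1], comparing with [T] would give [V T <= V (T+1)],
    since both transmissions lead to 0. So waiting attains it, and [V (T+2) - V (T+1) = J - f (T+1)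
    <= J - f T <= V (T+1) - V T]. *)
Lemma descent_propagates (T : nat) (d : R) :
  rs = 1 -> 0 < d -> V T.+1 <= V T - d -> V T.+2 <= V T.+1 - d.
Proof.
move=> rs1 d0 dV.
have := bellman_attained T.+1; have := bellman_le T; have := hf (leqnSn T).
by rewrite rs1 => ? [? ?] [] ?; lra.
Qed.

Lemma relative_value_nondecreasing_rs1 (T : nat) : rs = 1 -> V T <= V T.+1.
Proof.
move=> rs1; rewrite leNgt; apply/negP => VT.
have [_ _ /(_ rs1)[m mV]] := hV.
have d0 : 0 < V T - V T.+1 by rewrite subr_gt0.
have dec k : V (T + k).+1 <= V (T + k)%N - (V T - V T.+1).
  elim: k => [|k]; first by rewrite addn0; lra.
  by rewrite addnS; exact: descent_propagates.
have lin k : V (T + k)%N <= V T - k%:R * (V T - V T.+1).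
  elim: k => [|k IHk]; first by rewrite addn0 mul0r subr0.
  by rewrite addnS -natr1; move: (dec k); lra.
have [k hk] : exists k : nat, (V T - m) / (V T - V T.+1) < k%:R.
  by exists (Num.bound ((V T - m) / (V T - V T.+1))); rewrite archi_boundP//
    divr_ge0 ?subr_ge0// ltW.
by move: hk (lin k) (mV (T + k)%N); rewrite ltr_pdivrMr//; lra.
Qed.

(* The subsolution is [V + e * phi] frozen from [T] on: it has to gain [e] at
   every step although the next state may only count with weight [1 - rs],
   whence (1 - rs) phi(k+1) = phi(k) + 1. *)
Lemma relative_value_nondecreasing_rs_lt1 (T : nat) : rs < 1 -> V T <= V T.+1.
Proof.
move=> rs1; rewrite leNgt; apply/negP => VT.
have /andP[rs0 _] := hrs.
pose phi := fix phi k := if k is k'.+1 then (phi k' + 1) / (1 - rs) else 0.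
have q0 : 0 < 1 - rs by rewrite subr_gt0.
have phiS k : (1 - rs) * phi k.+1 = phi k + 1.
  by rewrite /= mulrC divfK // gt_eqF.
have phi0 k : 0 <= phi k.
  by elim: k => //= k IHk; rewrite divr_ge0 ?(ltW q0) // addr_ge0.
(* Chosen so that [e * (1 + phi T)] is exactly the slack at [T] when transmitting; the slack when
   waiting lacks the factor [1 - rs], so it is no smaller. *)
pose e := (1 - rs) * (V T - V T.+1) / (1 + phi T).
have pT : 0 < 1 + phi T by rewrite ltr_pwDl.
have e0 : 0 < e by rewrite divr_gt0 ?mulr_gt0 ?subr_gt0.
have eE : e + e * phi T = (1 - rs) * (V T - V T.+1).
  by rewrite -[X in X + _]mulr1 -mulrDr /e divfK // gt_eqF.
pose W t := V (minn t T) + e * phi (minn t T).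
have W0 : W 0%N = V 0%N by rewrite /W min0n /= mulr0 addr0.
have WQ t a : W t <= Qfactor rs c (J + e) W t a.
  rewrite /Qfactor expect_nextE cE W0 /W.
  (* Below [T] the recursion for [phi] pays for [e]; as [phi 0 = 0], a return to state 0 contributes
     no gain. From [T] on, the slack at [T] pays, and [f t >= f T]. *)
  have [tT|Tt] := ltnP t T.
    have -> : minn t.+1 T = t.+1 by apply/minn_idPl.
    have [b0 b1] := bellman_le t.
    have pS := phiS t; have := phi0 t.+1; move: (phi t.+1) pS => y pS y0.
    have ? : 0 <= e * y by rewrite mulr_ge0 // ltW.
    have ? : e * ((1 - rs) * y) = e * (phi t + 1) by rewrite pS.
    by case: a => /=; nra.
  have -> : minn t.+1 T = T by apply/minn_idPr/leqW.
  have [b0 b1] := bellman_le T; have ft := hf Tt.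
  have ep : 0 <= e * phi T by rewrite mulr_ge0 // ltW.
  by case: a => /=; nra.
(* [W] takes only its values at [0, ..., T]. *)
pose B := \sum_(i < T.+1) `|W i|.
have WB t : W t <= B.
  have -> : W t = W (minn t T) by rewrite /W -minnA minnn.
  have lt : (minn t T < T.+1)%N by rewrite ltnS geq_minr.
  rewrite /B (bigD1 (Ordinal lt)) //= (le_trans (ler_norm _)) // lerDl.
  exact: sumr_ge0.
have [JE _ _] := hV.
(* Half of [e] is given up because [average_cost_ge] needs a constant strictly below [J + e]. *)
suff : ((J + e / 2)%:E <= J%:E)%E by rewrite lee_fin; lra.
rewrite -JE; apply: le_ereal_inf_tmp => _ [pi ppi <-].
by apply: average_cost_ge ppi WQ WB _ => //; lra.
Qed.

Lemma relative_value_nondecreasing :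
  {homo V : s t / (s <= t)%N >-> s <= t}.
Proof.
apply: homo_leq => [//||T]; first exact: le_trans.
have /andP[_] := hrs; rewrite le_eqVlt => /predU1P[|].
  exact: relative_value_nondecreasing_rs1.
exact: relative_value_nondecreasing_rs_lt1.
Qed.

End RelativeValueFunction.

Theorem lemma3 (R : realType) (n p : nat)
    (A : 'M[R]_n) (C : 'M[R]_(p, n))
    (Sigma_w : 'M[R]_n) (Sigma_v : 'M[R]_p) (Pi0 : 'M[R]_n)
    (sqrt_Sigma_w Pbar : 'M[R]_n) (lambda rs J : R) (V : nat -> R)
    (hSw : possemidef Sigma_w) (hPi0 : possemidef Pi0) (hSv : posdef Sigma_v)
    (hdet : detectable A C)
    (hsqrt : is_sqrt_mx sqrt_Sigma_w Sigma_w)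
    (hstab : stabilizable A sqrt_Sigma_w)
    (hPbar : steady_state_cov A C Sigma_w Sigma_v Pi0 Pbar)
    (hrs : 0 <= rs <= 1)
    (hV : relative_value_function rs (stage_cost A Sigma_w Pbar lambda) J V) :
  forall (a : bool) (tau tau' : nat), (tau' <= tau)%N ->
    Qfactor rs (stage_cost A Sigma_w Pbar lambda) J V tau' a <=
    Qfactor rs (stage_cost A Sigma_w Pbar lambda) J V tau a.
Proof.
move=> a tau tau' le_tau.
have hf := trace_remote_cov_le hSw hSv hPi0 hPbar.
have VS := relative_value_nondecreasing hf (fun _ _ => erefl) hrs hV.
(* For a fixed action, the communication cost and the [V 0] term are common to both sides. *)
rewrite /Qfactor !expect_nextE lerD2r lerD ?lerD2r ?hf// lerD2l.
rewrite ler_wpM2r ?VS//; case: a; rewrite ?ler01//.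
by rewrite subr_ge0; case/andP: hrs.
Qed.
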